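(* Suppose that $F:\mathbb{R}^n\to\mathbb{R}^n$ is continuously differentiable on $\mathbb{R}^n$. Let $\{\eta_k\}$ be a positive sequence satisfying $\sum_{k=0}^\infty\eta_k<\eta<\infty$, and let $\{x_k\}$ be the sequence generated by the SRAND algorithm (described in the context) with parameter $\rho\in(0,1)$. Assume that $J_S(x^* )$ is indefinite and $J(x^* )$ is nonsingular at the limit point $x^*$ of $\{x_k\}$. Let $\sigma_{\max}(J(x^* ))$ be the largest singular value of $J(x^* )$. If, for some $\epsilon\in(0,1)$ and $\nu>0$, the two conditions $$\nu\ge|\beta_k|>\frac{\rho}{(1+\epsilon)\,\sigma_{\max}(J(x^* ))}\qquad\text{and}\qquad \big|\beta_k\,q\big((G_S)_k,F_k\big)\big|>\frac32\rho$$ hold for all sufficiently large $k$, then $F(x^* )=0$.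
   Context: Notation: $\|\cdot\|$ is the Euclidean norm; $F_k=F(x_k)$; $J$ is the Jacobian matrix of $F$; for a square matrix $A$, $A_S=\frac12(A+A^T)$, so $J_S$ is the symmetric part of $J$. A symmetric matrix is indefinite if its smallest eigenvalue is negative and its largest eigenvalue is positive. With $p_k=x_{k+1}-x_k$, $(G_S)_k=\int_0^1J_S(x_k+t\,p_k)\,dt$. The Rayleigh quotient of a symmetric matrix $M$ at a nonzero vector $p$ is $q(M,p)=\frac{p^TMp}{p^Tp}$. SRAND algorithm. Given $x_0\in\mathbb{R}^n$, $0<\beta_{\min}<\beta_{\max}$, $\beta_0\in[\beta_{\min},\beta_{\max}]$, $\rho,\sigma\in(0,1)$ and a positive sequence $\{\eta_k\}$ with $\sum_k\eta_k<\eta<\infty$. If $\|F_0\|=0$ stop. For $k=0,1,2,\dots$: Step 1: set $\gamma=1$. Step 2: repeat: set $p_-=-\gamma\beta_kF_k$ and $p_+=\gamma\beta_kF_k$. Consider the linesearch conditions on a trial step $p$: (L1) $\|F(x_k+p)\|\le\big(1-\rho(1+\gamma)\big)\|F_k\|$, (L2) $\|F(x_k+p)\|\le(1+\eta_k-\rho\gamma)\|F_k\|$. If $p_-$ satisfies (L1), set $p_k=p_-$ and go to Step 3; else if $p_+$ satisfies (L1), set $p_k=p_+$ and go to Step 3; else if $p_-$ satisfies (L2), set $p_k=p_-$ and go to Step 3; else if $p_+$ satisfies (L2), set $p_k=p_+$ and go to Step 3; otherwise set $\gamma=\sigma\gamma$ and repeat Step 2. Step 3: set $\gamma_k=\gamma$,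 $x_{k+1}=x_k+p_k$. Step 4: if $\|F_{k+1}\|=0$ stop. Step 5: choose $\beta_{k+1}$ such that $|\beta_{k+1}|\in[\beta_{\min},\beta_{\max}]$. The choice of $\beta_{k+1}$ in Step 5 is otherwise arbitrary. The sequence $\{x_k\}$ considered is infinite (the algorithm does not stop, so $F_k\neq0$ for all $k$). It is a known property of the algorithm that, for any choice of the steplengths, $\{x_k\}$ is convergent; $x^*$ denotes its limit, and ''limit point'' refers to it. It is also known that $\{\|F_k\|\}$ converges and $\lim_{k\to\infty}\gamma_k\|F_k\|=0$. *)

(* Defs.v *)
From HB Require Import structures.
From mathcomp Require Import all_boot all_order all_algebra.
From mathcomp Require Import all_classical all_reals all_analysis.

Set Implicit Arguments.
Unset Strict Implicit.
Unset Printing Implicit Defensive.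

Import Order.TTheory GRing.Theory Num.Theory.
Import numFieldNormedType.Exports.

Local Open Scope classical_set_scope.
Local Open Scope ring_scope.

(* Points of R^n are row vectors ['rV[R]_n], because [jacobian] and the
   topology on matrices are set up that way in the library. *)

(* The library norm on matrices is the sup norm, hence this definition. *)
Definition enorm (R : realType) (n : nat) (v : 'rV[R]_n) : R :=
  Num.sqrt (\sum_(i < n) v 0 i ^+ 2).

(* [jacobian F x] acts on row vectors, 'D_v F x = v *m jacobian F x; its
   transpose is the usual matrix with (i, j) entry dF_i/dx_j. *)
Definition jac (R : realType) (n : nat) (F : 'rV[R]_n -> 'rV[R]_n)
    (x : 'rV[R]_n) : 'M[R]_n :=
  (jacobian F x)^T.

Definition continuously_differentiable (R : realType) (n : nat)
    (F : 'rV[R]_n -> 'rV[R]_n) : Prop :=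
  (forall x, differentiable F x) /\ continuous (jac F).

Definition sympart (R : realType) (n : nat) (A : 'M[R]_n) : 'M[R]_n :=
  2^-1 *: (A + A^T).

Definition is_min_eigenvalue (R : realType) (n : nat) (A : 'M[R]_n) (a : R) :
    Prop :=
  eigenvalue A a /\ forall b, eigenvalue A b -> a <= b.

Definition is_max_eigenvalue (R : realType) (n : nat) (A : 'M[R]_n) (a : R) :
    Prop :=
  eigenvalue A a /\ forall b, eigenvalue A b -> b <= a.

Definition indefinite (R : realType) (n : nat) (A : 'M[R]_n) : Prop :=
  A^T = A /\
  exists a b, [/\ is_min_eigenvalue A a, is_max_eigenvalue A b, a < 0 & 0 < b].

Definition singular_values (R : realType) (n : nat) (A : 'M[R]_n) : set R :=
  [set s | 0 <= s /\ eigenvalue (A^T *m A) (s ^+ 2)].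

(* For 0 < n the set of singular values is finite and nonempty, so that its
   supremum is its largest element. *)
Definition sigma_max (R : realType) (n : nat) (A : 'M[R]_n) : R :=
  sup (singular_values A).

(* p^T M p / p^T p, with p^T the row vector [p] *)
Definition rayleigh (R : realType) (n : nat) (M : 'M[R]_n) (p : 'rV[R]_n) : R :=
  (p *m M *m p^T) 0 0 / (p *m p^T) 0 0.

(* The entrywise integral of J_S over the segment from x to x + p *)
Definition GS (R : realType) (n : nat) (F : 'rV[R]_n -> 'rV[R]_n)
    (x p : 'rV[R]_n) : 'M[R]_n :=
  \matrix_(i < n, j < n)
    \int[@lebesgue_measure R]_(t in `[0, 1]) sympart (jac F (x + t *: p)) i j.

(* One pass of the linesearch at the point [x] with spectral coefficient
   [beta] and trial value [gamma]: the accepted step, or [None] if [gamma] has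
   to be reduced. *)
Definition srand_trial (R : realType) (n : nat) (F : 'rV[R]_n -> 'rV[R]_n)
    (rho eta beta : R) (x : 'rV[R]_n) (gamma : R) : option 'rV[R]_n :=
  let pm := - (gamma * beta *: F x) in
  let pp := gamma * beta *: F x in
  let L1 p := enorm (F (x + p)) <= (1 - rho * (1 + gamma)) * enorm (F x) in
  let L2 p := enorm (F (x + p)) <= (1 + eta - rho * gamma) * enorm (F x) in
  if L1 pm then Some pm
  else if L1 pp then Some pp
  else if L2 pm then Some pm
  else if L2 pp then Some pp
  else None.

(* [gamma] is the first of 1, sigma, sigma^2, ... at which a step is accepted,
   and [p] is that step. *)
Definition srand_linesearch (R : realType) (n : nat)
    (F : 'rV[R]_n -> 'rV[R]_n) (rho sigma eta beta : R) (x : 'rV[R]_n)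
    (gamma : R) (p : 'rV[R]_n) : Prop :=
  exists m : nat,
    [/\ gamma = sigma ^+ m,
        srand_trial F rho eta beta x (sigma ^+ m) = Some p
      & forall j, (j < m)%N -> srand_trial F rho eta beta x (sigma ^+ j) = None].

Record srand_parameters (R : realType) (beta_min beta_max rho sigma eta : R)
    (eta_ : nat -> R) : Prop := SrandParameters {
  srand_beta_min : 0 < beta_min;
  srand_beta_max : beta_min < beta_max;
  srand_rho : 0 < rho < 1;
  srand_sigma : 0 < sigma < 1;
  srand_eta_gt0 : forall k, 0 < eta_ k;
  srand_eta_sum : (\sum_(0 <= k <oo) (eta_ k)%:E < eta%:E)%E
}.

(* An infinite run; the iterates [x], coefficients [beta] and linesearch
   parameters [gamma] are those of the algorithm, the choice of [beta] within
   its bounds being free. *)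
Record srand_run (R : realType) (n : nat) (F : 'rV[R]_n -> 'rV[R]_n)
    (beta_min beta_max rho sigma : R) (eta_ : nat -> R)
    (x : nat -> 'rV[R]_n) (beta gamma : nat -> R) : Prop := SrandRun {
  srand_beta0 : beta_min <= beta 0%N <= beta_max;
  srand_betaS : forall k, beta_min <= `|beta k.+1| <= beta_max;
  srand_nonstop : forall k, enorm (F (x k)) != 0;
  srand_step : forall k,
    srand_linesearch F rho sigma (eta_ k) (beta k) (x k) (gamma k)
      (x k.+1 - x k)
}.

(* Main.v *)
Require Import Defs.
From HB Require Import structures.
From mathcomp Require Import all_boot all_order all_algebra.
From mathcomp Require Import all_classical all_reals all_analysis.
From mathcomp Require Import ring lra.

Set Implicit Arguments.
Unset Strict Implicit.
Unset Printing Implicit Defensive.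

Import Order.TTheory GRing.Theory Num.Theory.
Import numFieldNormedType.Exports.

Local Open Scope classical_set_scope.
Local Open Scope ring_scope.

(** The proof is by contradiction, from two estimates of one quadratic form
    that cannot hold together.  Write z for the limit of the iterates.

    Suppose that F(z) is not 0.  The step p_k is gamma_k beta_k F_k up to sign,
    it tends to 0 because the iterates converge, and |beta_k| and |F_k| are
    bounded away from 0; so gamma_k < 1 for large k, and the linesearch rejected
    the previous trial value gamma = gamma_k / sigma in both directions.  Since
    eta_k > 0, the failure of the weaker condition (L2) gives
    |F(x_k +- gamma beta_k F_k)| >= (1 - rho gamma) |F_k|.  The mean value
    theorem along each of the two segments [enorm_mean_value] turns this into a
    bound on slopes [rejected_slope]: there are points y+ and y- on the segments
    such that
      beta_k F(y+)^T J(y+) F_k >= - rho |F_k|^2  and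
      beta_k F(y-)^T J(y-) F_k <= rho |F_k|^2.

    On the other hand the hypothesis on the Rayleigh quotient says that
    |beta_k F_k^T (G_S)_k F_k| > 3/2 rho |F_k|^2.  The trial steps also tend
    to 0, so that y+, y- and the whole segment over which (G_S)_k averages
    shrink to z.  Hence all three forms, without the factor beta_k, tend to
    F(z)^T J(z) F(z) [cvg_mxform_jac, cvg_GS]; a matrix and its symmetric part
    have the same quadratic form [mxform_sympart].  As |beta_k| <= nu, the forms
    times beta_k differ by less than rho |F_k|^2 / 2 for large k, which
    contradicts the gap between rho and 3/2 rho [slope_gap]. *)

(** * Bilinear forms of matrices and the Euclidean norm *)

Definition mxform (R : realType) (n : nat) (u : 'rV[R]_n) (M : 'M[R]_n)
    (v : 'rV[R]_n) : R :=
  (u *m M *m v^T) 0 0.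

Lemma mxformE (R : realType) n (u : 'rV[R]_n) M v :
  mxform u M v = \sum_j (\sum_i u 0 i * M i j) * v 0 j.
Proof.
by rewrite /mxform mxE; apply: eq_bigr => j _; rewrite !mxE.
Qed.

Lemma mxformZr (R : realType) n (u : 'rV[R]_n) M a v :
  mxform u M (a *: v) = a * mxform u M v.
Proof. by rewrite /mxform linearZ /= -scalemxAr mxE. Qed.

(** This is why the Rayleigh quotients of J_S can be compared with the slopes of
    the residual, which involve J itself. *)
Lemma mxform_sympart (R : realType) n (A : 'M[R]_n) (p : 'rV[R]_n) :
  mxform p (sympart A) p = mxform p A p.
Proof.
have tr : (p *m A^T *m p^T) 0 0 = (p *m A *m p^T) 0 0.
  by rewrite -[in LHS](trmxK p) -!trmx_mul mxE trmxK mulmxA.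
rewrite /mxform /sympart -scalemxAr -scalemxAl mulmxDr mulmxDl !mxE /=.
rewrite !mxE in tr; rewrite tr; lra.
Qed.

Lemma enorm_sqr (R : realType) n (v : 'rV[R]_n) :
  enorm v ^+ 2 = (v *m v^T) 0 0.
Proof.
rewrite /enorm sqr_sqrtr ?sumr_ge0// => [|i _]; last exact: sqr_ge0.
by rewrite mxE; apply: eq_bigr => i _; rewrite mxE.
Qed.

Lemma enorm_eq0 (R : realType) n (v : 'rV[R]_n) : (enorm v == 0) = (v == 0).
Proof.
apply/idP/eqP => [|->]; last first.
  by rewrite /enorm big1 ?sqrtr0// => i _; rewrite mxE expr0n.
rewrite -sqrf_eq0 enorm_sqr mxE psumr_eq0 => [/allP v0|i _].
  apply/rowP => i; rewrite mxE; apply/eqP; rewrite -sqrf_eq0 expr2.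
  by have := v0 i (mem_index_enum _); rewrite mxE.
by rewrite mxE -expr2 sqr_ge0.
Qed.

Lemma cvg_sumr (R : realType) (T : Type) (G : set_system T) (FG : Filter G)
    n (f : 'I_n -> T -> R) (l : 'I_n -> R) :
  (forall i, f i t @[t --> G] --> l i) ->
  (\sum_i f i t) @[t --> G] --> \sum_i l i.
Proof. by move=> fl; apply: cvg_big => //; exact: add_continuous. Qed.

Lemma cvg_mxform (R : realType) (T : Type) (G : set_system T) (FG : Filter G)
    n (u v : T -> 'rV[R]_n) (M : T -> 'M[R]_n) u0 v0 (M0 : 'M[R]_n) :
  u t @[t --> G] --> u0 ->
  (forall i j, M t i j @[t --> G] --> M0 i j) ->
  v t @[t --> G] --> v0 ->
  mxform (u t) (M t) (v t) @[t --> G] --> mxform u0 M0 v0.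
Proof.
move=> uu MM vv; rewrite mxformE; under eq_cvg do rewrite mxformE.
have cvg_coord (w : T -> 'rV[R]_n) (w0 : 'rV[R]_n) j :
    w t @[t --> G] --> w0 -> w t 0 j @[t --> G] --> w0 0 j.
  move=> ww.
  exact: (continuous_cvg _ (@coord_continuous R 1 n 0 j w0) ww).
apply: cvg_sumr => j; apply: cvgM; last exact: cvg_coord.
by apply: cvg_sumr => i; apply: cvgM; [exact: cvg_coord|exact: MM].
Qed.

Lemma cvg_enorm_sqr (R : realType) (T : Type) (G : set_system T)
    (FG : Filter G) n (v : T -> 'rV[R]_n) (v0 : 'rV[R]_n) :
  v t @[t --> G] --> v0 -> enorm (v t) ^+ 2 @[t --> G] --> enorm v0 ^+ 2.
Proof.
move=> vv; rewrite enorm_sqr -[v0 in X in X *m _]mulmx1.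
under eq_cvg do rewrite enorm_sqr -[v _ in X in X *m _]mulmx1.
by apply: cvg_mxform => // i j; exact: cvg_cst.
Qed.

(** * Slopes of the residual and the averaged Jacobian *)

(** Stated as a limit in the pair because the mean value point differs from the
    iterate, and nothing is known about it but that it is close to [x0]: the
    bound must be uniform over all such points. *)
Lemma cvg_mxform_jac (R : realType) n (F : 'rV[R]_n -> 'rV[R]_n) :
  continuous F -> continuous (jac F) -> forall x0 : 'rV[R]_n,
  mxform (F yz.1) (jac F yz.1) (F yz.2) @[yz --> (x0, x0)] -->
    mxform (F x0) (jac F x0) (F x0).
Proof.
move=> Fc Jc x0.
have F1 : F yz.1 @[yz --> (x0, x0)] --> F x0.
  by apply: (@cvg_comp _ _ _ fst F); [exact: cvg_fst|exact: Fc].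
have F2 : F yz.2 @[yz --> (x0, x0)] --> F x0.
  by apply: (@cvg_comp _ _ _ snd F); [exact: cvg_snd|exact: Fc].
have J1 : jac F yz.1 @[yz --> (x0, x0)] --> jac F x0.
  by apply: (@cvg_comp _ _ _ fst (jac F)); [exact: cvg_fst|exact: Jc].
apply: cvg_mxform => // i j.
exact: (continuous_cvg _ (@coord_continuous R n n i j (jac F x0)) J1).
Qed.

(** The gradient of |F|^2 is 2 J^T F.  The square of the norm is used because it
    is differentiable everywhere, also at the zeros of [F]. *)
Lemma enorm_mean_value (R : realType) n (F : 'rV[R]_n -> 'rV[R]_n)
    (x d : 'rV[R]_n) :
  (forall y, differentiable F y) ->
  exists2 c, c \in `[0, 1] & enorm (F (x + d)) ^+ 2 - enorm (F x) ^+ 2 =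
    2 * mxform (F (x + c *: d)) (jac F (x + c *: d)) d.
Proof.
move=> dF.
have dFl (c : R) :
    is_derive c 1 (fun t : R => F (x + t *: d)) ('D_d F (x + c *: d)).
  (* the difference quotients that define the two derivatives coincide *)
  have lineE : (fun h : R => h^-1 *:
        (((fun t : R => F (x + t *: d)) \o shift c) (h *: 1) -
          F (x + c *: d))) =
      (fun h => h^-1 *: ((F \o shift (x + c *: d)) (h *: d) - F (x + c *: d))).
    apply/funext => h /=; do 3 f_equal.
    by rewrite [h *: 1]mulr1 scalerDl addrCA.
  apply: DeriveDef; last by rewrite /derive lineE.
  by rewrite /derivable lineE; exact: diff_derivable.
have dcoord (c : R) i : is_derive c 1 (fun t : R => F (x + t *: d) 0 i)
     ((d *m jacobian F (x + c *: d)) 0 i).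
  have [der val] := dFl c.
  apply: DeriveDef; first by move/derivable_mxP : der; exact.
  by rewrite -deriveEjacobian// -val derive_mx// mxE.
pose phi : R -> R := \sum_(i < n) (fun t : R => F (x + t *: d) 0 i) ^+ 2.
have phiE t : phi t = enorm (F (x + t *: d)) ^+ 2.
  rewrite enorm_sqr mxE /phi fct_sumE; apply: eq_bigr => i _.
  by rewrite mxE.
have dphi (c : R) : is_derive c 1 phi
    (2 * mxform (F (x + c *: d)) (jac F (x + c *: d)) d).
  apply: is_derive_eq.
  rewrite /mxform /jac -mulmxA -trmx_mul mxE mulr_sumr.
  apply: eq_bigr => i _; rewrite mxE expr1 /GRing.scale /= mulrA.
  by rewrite !mxE.
have [c c01 phi01] := @MVT_segment R phi _ 0 1 ler01 (fun (c : R) _ => dphi c)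
  (derivable_within_continuous
    (fun c _ => @ex_derive _ _ _ _ _ _ _ (dphi c))).
exists c => //; move: phi01.
by rewrite !phiE scale1r scale0r addr0 subr0 mulr1.
Qed.

(** The segments are eventually contained in any ball around [x0], on which the
    integrand is as close to its value at [x0] as desired. *)
Lemma cvg_segment_mean (R : realType) n (h : 'rV[R]_n -> R) (T : Type)
    (G : set_system T) (FG : Filter G) (x p : T -> 'rV[R]_n) (x0 : 'rV[R]_n) :
  continuous h -> x t @[t --> G] --> x0 -> p t @[t --> G] --> (0 : 'rV[R]_n) ->
  (\int[@lebesgue_measure R]_(s in `[0, 1]) h (x t + s *: p t)) @[t --> G]
    --> h x0.
Proof.
move=> hc xx p0; apply/cvgrPdist_le => e e0.
have [r /= r0 hr] := (nbhs_normP _ _).1 ((cvgrPdist_le _ _).1 (hc x0) e e0).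
near=> t.
have hseg s : s \in `[0, 1] -> `|h x0 - h (x t + s *: p t)| <= e.
  rewrite in_itv/= => /andP[s0 s1]; apply: hr => /=.
  rewrite opprD addrA (splitr r).
  apply: le_lt_trans (ler_normB _ _) _; apply: ltrD.
    near: t; apply: (cvgr_dist_lt _ _ xx); lra.
  apply: (@le_lt_trans _ _ `|p t|).
    by rewrite normrZ ger0_norm// ler_piMl.
  by near: t; apply: (cvgr0_norm_lt _ p0); rewrite ?divr_gt0.
have hint (f : R -> R) : continuous f ->
    (@lebesgue_measure R).-integrable `[0, 1] (EFin \o f).
  move=> fc; apply: continuous_compact_integrable; first exact: segment_compact.
  exact: continuous_subspaceT.
have mean_cst (c : R) : \int[@lebesgue_measure R]_(s in `[0, 1]) c = c.
  rewrite Rintegral_cst// [X in fine X](_ : _ = 1%E) ?mulr1//.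
  apply: etrans (lebesgue_measure_itv _) _.
  by rewrite /= lte_fin ltr01 oppr0 adde0.
have hline : continuous (fun s : R => h (x t + s *: p t)).
  move=> s; apply: (@continuous_comp _ _ _ (fun s : R => x t + s *: p t) h);
    last exact: hc.
  apply: cvgD; first exact: cvg_cst.
  by apply: cvgZr_tmp; exact: cvg_id.
rewrite -[X in X - _]mean_cst -RintegralB//; try by apply: hint.
  apply: le_trans (le_normr_Rintegral _ _) _ => //.
    apply: hint => s; apply: cvgB; [exact: cvg_cst|exact: hline].
  rewrite -[leRHS]mean_cst; apply: le_Rintegral => //.
  - apply: hint => s; apply: cvg_norm.
    by apply: cvgB; [exact: cvg_cst|exact: hline].
  - by apply: hint => s; exact: cvg_cst.
by apply: hint => s; exact: cvg_cst.
Unshelve. all: by end_near. Qed.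

Lemma cvg_GS (R : realType) n (F : 'rV[R]_n -> 'rV[R]_n) (T : Type)
    (G : set_system T) (FG : Filter G) (x p : T -> 'rV[R]_n) (x0 : 'rV[R]_n)
    i j :
  continuous (jac F) ->
  x t @[t --> G] --> x0 -> p t @[t --> G] --> (0 : 'rV[R]_n) ->
  GS F (x t) (p t) i j @[t --> G] --> sympart (jac F x0) i j.
Proof.
move=> Jc xx p0; under eq_cvg do rewrite mxE.
apply: (@cvg_segment_mean _ _ (fun y => sympart (jac F y) i j)) => //.
have Jij k l : continuous (fun y => jac F y k l).
  move=> y.
  exact: (continuous_cvg _ (@coord_continuous R n n k l (jac F y)) (Jc y)).
have -> : (fun y => sympart (jac F y) i j) =
    (fun y => 2^-1 * (jac F y i j + jac F y j i)).
  by apply/funext => y; rewrite !mxE.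
by move=> y; exact: cvgM (cvg_cst _) (cvgD (Jij i j y) (Jij j i y)).
Qed.

(** * The linesearch *)

Lemma srand_trial_step (R : realType) n (F : 'rV[R]_n -> 'rV[R]_n)
    (rho eta beta gamma : R) (x p : 'rV[R]_n) :
  srand_trial F rho eta beta x gamma = Some p ->
  p = - (gamma * beta *: F x) \/ p = gamma * beta *: F x.
Proof.
by rewrite /srand_trial; do 4 (case: ifP => _; first by case=> <-; auto).
Qed.

(** Only the failure of the weaker condition (L2) is kept.  Without [eta] the
    bound is an equality at [gamma = 0], so that division by [gamma] yields a
    bound on the slope. *)
Lemma rejected_trial (R : realType) n (F : 'rV[R]_n -> 'rV[R]_n)
    (rho eta beta gamma : R) (x : 'rV[R]_n) (b : R) :
  srand_trial F rho eta beta x gamma = None ->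
  0 <= eta -> (b = beta \/ b = - beta) ->
  (1 - rho * gamma) * enorm (F x) <= enorm (F (x + (gamma * b) *: F x)).
Proof.
rewrite /srand_trial => rej eta0 b_beta.
have L2 : (1 - rho * gamma) * enorm (F x) <=
    (1 + eta - rho * gamma) * enorm (F x).
  by rewrite ler_wpM2r ?sqrtr_ge0//; lra.
move: rej; case: ifP => // _; case: ifP => // _.
case: ifPn => //; rewrite -ltNge => pm.
case: ifPn => //; rewrite -ltNge => pp _.
case: b_beta => ->; apply: (le_trans L2); apply: ltW => //.
by rewrite mulrN scaleNr.
Qed.

(** By the mean value theorem the change of |F|^2 along the trial step is
    2 gamma times the form below, while it is at least
    ((1 - rho gamma)^2 - 1) |F(x)|^2 >= - 2 rho gamma |F(x)|^2. *)
Lemma rejected_slope (R : realType) n (F : 'rV[R]_n -> 'rV[R]_n)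
    (rho gamma b : R) (x : 'rV[R]_n) :
  (forall y, differentiable F y) ->
  0 < gamma -> rho * gamma <= 1 ->
  (1 - rho * gamma) * enorm (F x) <= enorm (F (x + (gamma * b) *: F x)) ->
  exists2 c, c \in `[0, 1] &
    let y := x + (c * (gamma * b)) *: F x in
    - (rho * enorm (F x) ^+ 2) <= b * mxform (F y) (jac F y) (F x).
Proof.
move=> dF g0 rg1 le.
have [c c01 mv] := enorm_mean_value x ((gamma * b) *: F x) dF.
exists c => //; rewrite /= -scalerA.
rewrite mxformZr in mv.
have e0 : 0 <= enorm (F x) by exact: sqrtr_ge0.
have sq : (1 - rho * gamma) ^+ 2 * enorm (F x) ^+ 2 <=
    enorm (F (x + (gamma * b) *: F x)) ^+ 2.
  rewrite -exprMn lerXn2r// nnegrE ?sqrtr_ge0//.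
  by apply: mulr_ge0 => //; lra.
rewrite -(ler_pM2l g0).
set q := mxform _ _ _ in mv *; set e := enorm (F x) in mv sq *.
have : 0 <= (rho * gamma * e) ^+ 2 by exact: sqr_ge0.
nra.
Qed.

(** * Convergence to a zero of the residual *)

(** The slope bounds hold for two different forms [q1] and [q2], neither of which
    is the form [A] of the averaged Jacobian; being close to the same [a], they
    confine |beta A| to 3/2 rho e. *)
Lemma slope_gap (R : realType) (beta nu A a d q1 q2 rho e : R) :
  `|beta| <= nu -> `|a - A| <= d -> `|a - q1| <= d -> `|a - q2| <= d ->
  - (rho * e) <= beta * q1 -> beta * q2 <= rho * e ->
  3 / 2 * rho * e < `|beta * A| ->
  ~ nu * (2 * d) < rho * e / 2.
Proof.
move=> bnu aA aq1 aq2 le1 le2 lb gap.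
have close q : `|a - q| <= d -> `|beta * A - beta * q| <= nu * (2 * d).
  move=> aq; rewrite -mulrBr normrM ler_pM//.
  by have := ler_normD (A - a) (a - q); rewrite addrA subrK (distrC A a); lra.
have := close _ aq1; have := close _ aq2.
rewrite !ler_norml => /andP[v1 v2] /andP[w1 w2].
by move: lb; rewrite ltr_normr => /orP[] lb; lra.
Qed.

Theorem theorem5p4 (R : realType) (n : nat) (F : 'rV[R]_n -> 'rV[R]_n)
    (beta_min beta_max rho sigma eta : R) (eta_ : nat -> R)
    (x : nat -> 'rV[R]_n) (beta gamma : nat -> R) (xstar : 'rV[R]_n)
    (eps nu : R) :
  continuously_differentiable F ->
  srand_parameters beta_min beta_max rho sigma eta eta_ ->
  srand_run F beta_min beta_max rho sigma eta_ x beta gamma ->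
  x @ \oo --> xstar ->
  indefinite (sympart (jac F xstar)) ->
  jac F xstar \in unitmx ->
  0 < eps < 1 ->
  0 < nu ->
  (\forall k \near \oo,
     rho / ((1 + eps) * sigma_max (jac F xstar)) < `|beta k| <= nu /\
     3 / 2 * rho < `|beta k * rayleigh (GS F (x k) (x k.+1 - x k)) (F (x k))|) ->
  F xstar = 0.
Proof.
move=> [dF Jc] [bmin0 _ /andP[rho0 rho1] /andP[sig0 sig1] eta0 _] run xx.
move=> _ _ _ nu0 cond.
apply/eqP; apply: contraT => Fx0.
have Fc : continuous F by move=> y; exact/differentiable_continuous/dF.
have p0 : (x k.+1 - x k) @[k --> \oo] --> (0 : 'rV[R]_n).
  rewrite -(subrr xstar); apply: cvgB => //.
  by rewrite (cvg_shiftS x).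
have Fx : F (x k) @[k --> \oo] --> F xstar.
  exact: (continuous_cvg _ (Fc xstar) xx).
pose b := enorm (F xstar) ^+ 2.
have b0 : 0 < b by rewrite exprn_even_gt0//= enorm_eq0.
have Bc : enorm (F (x k)) ^+ 2 @[k --> \oo] --> b by exact: cvg_enorm_sqr.
pose a := mxform (F xstar) (jac F xstar) (F xstar).
have Ac : mxform (F (x k)) (GS F (x k) (x k.+1 - x k)) (F (x k)) @[k --> \oo]
    --> a.
  rewrite /a -mxform_sympart; apply: cvg_mxform => // i j.
  exact: cvg_GS.
have gc := @cvg_mxform_jac R n F Fc Jc xstar.
(* 2 d nu = rho b / 4 is less than half of rho |F_k|^2 once |F_k|^2 > b / 2 *)
pose d := rho * b / (8 * nu).
have d0 : 0 < d by apply: divr_gt0; apply: mulr_gt0.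
have [r /= r0 gr] := (nbhs_normP _ _).1 ((cvgrPdist_le _ _).1 gc d d0).
have sF : 0 < `|F xstar| by rewrite normr_gt0.
have betak k : beta_min <= `|beta k|.
  case: k => [|k]; last by have /andP[] := srand_betaS run k.
  by have /andP[h _] := srand_beta0 run; exact: le_trans h (ler_norm _).
(* The first bound excludes that the full step, gamma = 1, was accepted; the
   second keeps the rejected trial step, longer by the factor 1 / sigma, within
   r / 2. *)
pose tau := Num.min (beta_min * (`|F xstar| / 2)) (sigma * (r / 2)).
have tau0 : 0 < tau by rewrite /tau lt_min !mulr_gt0 ?divr_gt0.
near \oo => k.
have [/andP[_ bnu] raylk] :
    rho / ((1 + eps) * sigma_max (jac F xstar)) < `|beta k| <= nu /\
    3 / 2 * rho < `|beta k * rayleigh (GS F (x k) (x k.+1 - x k)) (F (x k))|.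
  by near: k.
have pk : `|x k.+1 - x k| < tau.
  by near: k; apply: (cvgr0_norm_lt _ p0).
have xk : `|xstar - x k| < r / 2.
  by near: k; apply: (cvgr_dist_lt _ _ xx); lra.
have Fk : `|F xstar - F (x k)| < `|F xstar| / 2.
  by near: k; apply: (cvgr_dist_lt _ _ Fx); lra.
have Ak : `|a - mxform (F (x k)) (GS F (x k) (x k.+1 - x k)) (F (x k))| < d.
  by near: k; apply: (cvgr_dist_lt _ _ Ac).
have Bk : `|b - enorm (F (x k)) ^+ 2| < b / 2.
  by near: k; apply: (cvgr_dist_lt _ _ Bc); lra.
have [m [gamm acc rej]] := srand_step run k.
have pkE : `|x k.+1 - x k| = sigma ^+ m * (`|beta k| * `|F (x k)|).
  have -> : `|x k.+1 - x k| = `|sigma ^+ m * beta k *: F (x k)|.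
    by case: (srand_trial_step acc) => ->; rewrite ?normrN.
  by rewrite normrZ normrM (gtr0_norm (exprn_gt0 _ sig0)) mulrA.
have Fk2 : `|F xstar| / 2 <= `|F (x k)|.
  have := ler_normD (F xstar - F (x k)) (F (x k)); rewrite subrK; lra.
have bF : beta_min * (`|F xstar| / 2) <= `|beta k| * `|F (x k)|.
  by apply: ler_pM; [exact: ltW|lra|exact: betak|lra].
case: m => [|m] in gamm acc rej pkE *.
  move: pk; rewrite pkE expr0 mul1r lt_min => /andP[]; lra.
have {}rej := rej m (ltnSn m).
have sm0 : 0 < sigma ^+ m by rewrite exprn_gt0.
have rg1 : rho * sigma ^+ m <= 1.
  have sm1 : sigma ^+ m <= 1 by apply: exprn_ile1; exact: ltW.
  nra.
have ysmall c : c \in `[0, 1] -> forall s, `|s| = `|beta k| ->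
   let y := x k + (c * (sigma ^+ m * s)) *: F (x k) in
   `|a - mxform (F y) (jac F y) (F (x k))| <= d.
  rewrite in_itv/= => /andP[c0 c1] s sb; set y := x k + _.
  suff : ball_ Num.norm (xstar, xstar) r (y, x k) by move/gr.
  change (`|(xstar - y, xstar - x k)| < r).
  rewrite prod_normE gt_max /=; apply/andP; split; last by lra.
  rewrite /y opprD addrA (splitr r).
  apply: le_lt_trans (ler_normB _ _) _; apply: ltrD => //.
  rewrite normrZ !normrM sb (gtr0_norm sm0) (ger0_norm c0).
  move: pk; rewrite pkE lt_min => /andP[_].
  rewrite exprS -mulrA ltr_pM2l// => lt_r2.
  apply: le_lt_trans lt_r2; rewrite -!mulrA ler_piMl// !mulr_ge0//.
  exact: ltW.
have slope s : (s = beta k \/ s = - beta k) -> exists2 q,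
    `|a - q| <= d & - (rho * enorm (F (x k)) ^+ 2) <= s * q.
  move=> sb; have [c c01 le] := rejected_slope dF sm0 rg1
    (rejected_trial rej (ltW (eta0 k)) sb).
  eexists; last exact: le.
  by apply: ysmall => //; case: sb => ->; rewrite ?normrN.
have [q1 aq1 le1] := slope _ (or_introl erefl).
have [q2 aq2 le2] := slope _ (or_intror erefl).
move: raylk Ak; rewrite /rayleigh -enorm_sqr -/(mxform _ _ _).
set A := mxform _ _ _; set e := enorm _ ^+ 2 in Bk le1 le2 *.
have e0 : b / 2 < e by move: Bk; rewrite ltr_norml => /andP[_]; lra.
rewrite mulrA normrM normfV (gtr0_norm (_ : 0 < e)); last by lra.
rewrite ltr_pdivlMr; last by lra.
move=> lb /ltW aA; rewrite mulNr lerNl opprK in le2.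
have d_nu : nu * (2 * d) = rho * b / 4 by rewrite /d; field; rewrite gt_eqF.
have re : rho * (b / 2) < rho * e by rewrite ltr_pM2l.
have [] // := slope_gap bnu aA aq1 aq2 le1 le2 lb.
rewrite d_nu; lra.
Unshelve. all: by end_near. Qed.
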